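(* Assume Goldbach's conjecture: every even integer greater than $2$ is the sum of two primes. Let $f:\mathbb{N}\to\mathbb{C}$ be a multiplicative arithmetic function, and set $f(0)=0$. If $$f(p+q)+f(p-q)=2f(p)+2f(q)\quad\text{for all primes } p\ge q,$$ then $f(n)=n^2$ for all $n\in\mathbb{N}$.
   Context: $\mathbb{N}=\{1,2,3,\dots\}$ is the set of positive integers. A function $f:\mathbb{N}\to\mathbb{C}$ is multiplicative if $f(1)=1$ and $f(mn)=f(m)f(n)$ for all coprime positive integers $m,n$. The convention $f(0)=0$ is used to interpret the term $f(p-q)$ when $p=q$. *)

(* Defs.v *)
(* The complex numbers are modelled as R[i] for an arbitrary R : realType. *)
From mathcomp Require Export all_boot all_order all_algebra.
From mathcomp Require Export reals.
From mathcomp Require Export complex.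

Set Implicit Arguments.
Unset Strict Implicit.
Unset Printing Implicit Defensive.

Import GRing.Theory.

Definition goldbach_conjecture : Prop :=
  forall n : nat, (2 < n)%N -> ~~ odd n ->
  exists p q : nat, [/\ prime p, prime q & n = (p + q)%N].

(* An arithmetic function is a function on the positive integers, so nothing
   is required of the value f 0. *)
Definition multiplicative_arith (C : nzRingType) (f : nat -> C) : Prop :=
  f 1%N = 1%R /\
  forall m n : nat, (0 < m)%N -> (0 < n)%N -> coprime m n ->
    f (m * n)%N = (f m * f n)%R.

(* Main.v *)
Require Import Defs.
From mathcomp Require Import zify ring.

Set Implicit Arguments.
Unset Strict Implicit.

Import GRing.Theory.
Local Open Scope ring_scope.
Local Open Scope complex_scope.

(** The equation at (p, q) determines f (p + q), or f p, from its other values,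
    and the squares satisfy it; so everything rests on ordering the integers
    such that each value is reached from earlier ones.

    Give an even number or a prime n the weight n, and any other odd number n the
    weight 2n - 1, and induct on the weight.
    - An even n > 2 is p + q by Goldbach; p, q and the even number p - q are
      smaller.
    - For an odd composite n, write 2n = p + q by Goldbach.  The primes p and q and
      the even number p - q have weight less than 2n - 1, which gives
      f (2n) = (2n)^2, and f (2n) = f 2 * f n = 4 * f n.  This is the step that
      reaches odd prime powers, which do not split into coprime factors.
    - A prime p different from 2, 3, 5, 11 has a prime q <= p among 3, 5, 7, 17
      such that p + q = 4 * o with o odd: one prime for each odd residue of p
      modulo 8 ([prime_partner]).  Then f (p + q) = 16 * f o, where o has weight at
      most (p + q) / 2 - 1 < p, and p - q is even and smaller than p.

    The primes 2, 3, 5 and 11 come from a few instances of the equation with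
    small arguments ([square_at_2] to [square_at_11]). *)

Definition prime_quadratic (C : nzRingType) (f : nat -> C) : Prop :=
  forall p q : nat, prime p -> prime q -> (q <= p)%N ->
    f (p + q)%N + f (p - q)%N = 2%:R * f p + 2%:R * f q.

Definition square_at (C : nzRingType) (f : nat -> C) (n : nat) : Prop :=
  f n = n%:R ^+ 2.

(** * Propagating squares *)

Lemma square_atD (C : comNzRingType) (f : nat -> C) (p q : nat) :
  prime_quadratic f -> prime p -> prime q -> (q <= p)%N ->
  square_at f p -> square_at f q -> square_at f (p - q) ->
  square_at f (p + q).
Proof.
move=> fE pp pq leqp; rewrite /square_at => fp fq fB.
have := fE p q pp pq leqp; rewrite fp fq fB natrB // natrD => /eqP.
by rewrite -subr_eq0 => /eqP E; apply/eqP; rewrite -subr_eq0 -[X in _ == X]E;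
  apply/eqP; ring.
Qed.

Lemma square_at_prime (C : numFieldType) (f : nat -> C) (p q : nat) :
  prime_quadratic f -> prime p -> prime q -> (q <= p)%N ->
  square_at f q -> square_at f (p + q) -> square_at f (p - q) ->
  square_at f p.
Proof.
move=> fE pp pq leqp; rewrite /square_at => fq fD fB.
have n2 : (2%:R : C) != 0 by rewrite Num.Theory.pnatr_eq0.
apply: (mulfI n2); apply: (addIr (2%:R * f q)).
by rewrite -fE // fD fB fq natrB // natrD; ring.
Qed.

Lemma square_atM (C : comNzRingType) (f : nat -> C) (m n : nat) :
  multiplicative_arith f -> (0 < m)%N -> (0 < n)%N -> coprime m n ->
  square_at f m -> square_at f n -> square_at f (m * n).
Proof.
by move=> [_ fM] m0 n0 cop fm fn; rewrite /square_at fM // fm fn natrM exprMn.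
Qed.

(** * Small arguments *)

(** The pairs (p, p) give (f 2 - 4) * f p = 0 for odd p, while
    eliminating f 2 between (3, 2) and (5, 2) writes 1 = f 1 as an integer
    combination of f 3, f 5 and f 7. *)
Lemma square_at_2 (C : comNzRingType) (f : nat -> C) :
  multiplicative_arith f -> f 0%N = 0 -> prime_quadratic f -> square_at f 2.
Proof.
move=> [f1 fM] f0 fE.
have f2p p : prime p -> coprime 2 p -> (f 2%N - 4%:R) * f p = 0.
  move=> pp cop; have := fE p p pp pp (leqnn p).
  rewrite subnn f0 addr0 addnn -mul2n fM ?prime_gt0 // => E.
  by rewrite mulrBl E; ring.
have one : 1 = 3%:R * f 3%N - 3%:R * f 5%N + f 7%N.
  have /= := fE 3%N 2%N isT isT isT; rewrite f1 => E32.
  have /= E52 := fE 5%N 2%N isT isT isT.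
  have -> : f 7%N = 2%:R * f 5%N + 2%:R * f 2%N - f 3%N by rewrite -E52; ring.
  have -> : 2%:R * f 2%N = f 5%N + 1 - 2%:R * f 3%N.
    by rewrite E32; ring.
  by ring.
rewrite /square_at; apply/eqP; rewrite -subr_eq0; apply/eqP.
have -> : f 2%N - 2%:R ^+ 2 =
  3%:R * ((f 2%N - 4%:R) * f 3%N) - 3%:R * ((f 2%N - 4%:R) * f 5%N)
  + (f 2%N - 4%:R) * f 7%N
  + (f 2%N - 4%:R) * (1 - (3%:R * f 3%N - 3%:R * f 5%N + f 7%N)) by ring.
by rewrite !f2p // -one (subrr 1) !mulr0 subrr !addr0.
Qed.

Lemma square_at_4 (C : comNzRingType) (f : nat -> C) :
  f 0%N = 0 -> prime_quadratic f -> square_at f 2 -> square_at f 4.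
Proof.
by move=> f0 fE f2; apply: (@square_atD _ f 2 2) => //;
  rewrite subnn /square_at f0 expr0n.
Qed.

(** The pairs (3, 2) and (5, 2) express f 5 and f 7 through f 3; the pair (7, 5)
    then pins down f 3, because f 12 = f 4 * f 3. *)
Lemma square_at_3 (C : numFieldType) (f : nat -> C) :
  multiplicative_arith f -> prime_quadratic f ->
  square_at f 2 -> square_at f 4 -> square_at f 3.
Proof.
move=> [f1 fM] fE f2 f4.
have /= E32 := fE 3%N 2%N isT isT isT.
have /= E52 := fE 5%N 2%N isT isT isT.
have /= E75 := fE 7%N 5%N isT isT isT.
have f12 : f 12%N = f 4%N * f 3%N by rewrite -fM.
have f5 : f 5%N = 2%:R * f 3%N + 7%:R.
  by apply: (addIr (f 1%N)); rewrite E32 f1 f2; ring.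
have f7 : f 7%N = 3%:R * f 3%N + 22%:R.
  by apply: (addIr (f 3%N)); rewrite E52 f5 f2; ring.
have n6 : (6%:R : C) != 0 by rewrite Num.Theory.pnatr_eq0.
apply: (mulfI n6); apply/eqP; rewrite -subr_eq0; apply/eqP.
have -> : 6%:R * f 3%N - 6%:R * 3%:R ^+ 2 =
  f 12%N + f 2%N - (2%:R * f 7%N + 2%:R * f 5%N).
  by rewrite f12 f7 f5 f4 f2; ring.
by rewrite E75 subrr.
Qed.

Lemma square_at_5 (C : comNzRingType) (f : nat -> C) :
  multiplicative_arith f -> prime_quadratic f ->
  square_at f 2 -> square_at f 3 -> square_at f 5.
Proof.
move=> [f1 _] fE f2 f3.
by apply: (@square_atD _ f 3 2) => //; rewrite /square_at f1 expr1n.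
Qed.

(** The pair (11, 7) involves f 18 = f 2 * f 9, and (7, 2) gives f 9. *)
Lemma square_at_11 (C : numFieldType) (f : nat -> C) :
  multiplicative_arith f -> prime_quadratic f ->
  square_at f 2 -> square_at f 3 -> square_at f 4 -> square_at f 5 ->
  square_at f 11.
Proof.
move=> fM fE f2 f3 f4 f5.
have f7 : square_at f 7 by apply: (@square_atD _ f 5 2).
have f9 : square_at f 9 by apply: (@square_atD _ f 7 2).
have f18 : square_at f 18 by apply: (@square_atM _ f 2 9).
by apply: (@square_at_prime _ f 11 7).
Qed.

(** * The induction *)

(** The primes 3, 7, 17 and 5 are congruent to 3, 7, 1 and 5 modulo 8, so one of
    them is 4 - p modulo 8; the excluded odd p are those below that partner. *)
Lemma prime_partner (p : nat) : prime p -> p \notin [:: 2; 3; 5; 11]%N ->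
  exists q o : nat, [/\ prime q, (q <= p)%N, (p + q = 4 * o)%N & odd o].
Proof.
move=> pp; rewrite !inE !negb_or => /and4P[/eqP n2 /eqP n3 /eqP n5 /eqP n11].
have odd_p : odd p by case: (even_prime pp).
have p1 := prime_gt1 pp.
have pE := divn_eq p 8; move: (p %/ 8)%N (p %% 8)%N (ltn_pmod p (isT : 0 < 8)%N) pE.
move=> k r r8 pE.
have : [\/ r = 1, r = 3, r = 5 | r = 7]%N.
  have := odd_p; rewrite pE.
  by case: r r8 {pE} => [|[|[|[|[|[|[|[|r]]]]]]]] //= _ h; try lia;
    [constructor 1|constructor 2|constructor 3|constructor 4].
case=> rE; subst r.
- by exists 3%N, (2 * k + 1)%N; split=> //; lia.
- by exists 17%N, (2 * k + 5)%N; split=> //; lia.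
- by exists 7%N, (2 * k + 3)%N; split=> //; lia.
- by exists 5%N, (2 * k + 3)%N; split=> //; lia.
Qed.

(** Even numbers and primes n are reached at stage n, odd numbers n at stage
    2n - 1. *)
Lemma square_at_weight (C : numFieldType) (f : nat -> C) (N : nat) :
  goldbach_conjecture -> multiplicative_arith f -> f 0%N = 0 ->
  prime_quadratic f ->
  (forall n, (n <= N)%N -> ~~ odd n || prime n -> square_at f n) /\
  (forall n, odd n -> (2 * n <= N.+1)%N -> square_at f n).
Proof.
move=> gold fM f0 fE.
have f2 := square_at_2 fM f0 fE.
have f4 := square_at_4 f0 fE f2.
have f3 := square_at_3 fM fE f2 f4.
have f5 := square_at_5 fM fE f2 f3.
have f11 := square_at_11 fM fE f2 f3 f4 f5.
have sq0 : square_at f 0 by rewrite /square_at f0 expr0n.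
elim: N => [|N [IHeven IHodd]].
  by split=> n; [rewrite leqn0 => /eqP -> | lia].
(* Both Goldbach primes are at least 2, hence at most n - 2: this allows n up to
   N + 2, as needed for the double of the odd number reached at stage N + 1. *)
have even_case n : (2 < n)%N -> ~~ odd n -> (n <= N.+2)%N ->
  square_at f n.
  move=> n2 even_n nN; have [p [q [pp pq nE]]] := gold n n2 even_n.
  wlog leqp : p q pp pq nE / (q <= p)%N.
    by move=> W; case/orP: (leq_total q p) => h;
      [apply: (W p q)|apply: (W q p)] => //; rewrite addnC.
  have [p1 q1] := (prime_gt1 pp, prime_gt1 pq).
  rewrite nE; apply: square_atD => //; apply: IHeven; rewrite ?pp ?pq ?orbT //.
  + lia.
  + lia.
  + lia.
  + by apply/orP; left; rewrite oddB // -oddD -nE.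
split=> n.
- rewrite leq_eqVlt => /orP[/eqP nE|]; last exact: IHeven.
  case: (boolP (odd n)) => [odd_n /= pn | even_n _]; last first.
    have [n2|] := ltnP 2 n; first by apply: even_case; rewrite // nE.
    by case: n even_n {nE} => [|[|[|]]].
  have [|small] := boolP (n \in [:: 2; 3; 5; 11]%N).
    by rewrite !inE => /or4P[] /eqP ->.
  have [q [o [pq leqn nqE odd_o]]] := prime_partner pn small.
  have fq : square_at f q.
    have [qn|] := ltnP q n; first by apply: IHeven; [lia|rewrite pq orbT].
    (* q = n would make n + q = 2n twice an odd number. *)
    by move: nqE odd_n; lia.
  apply: (square_at_prime fE pn pq leqn fq).
    rewrite nqE; apply: square_atM => //; first lia.
      by rewrite (coprime_pexpl 2 o (isT : 0 < 2)%N) coprime2n.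
    by apply: IHodd => //; lia.
  by apply: IHeven; have := prime_gt1 pq; lia.
- move=> odd_n nN.
  have [n1|n1] := leqP n 1.
    have -> : n = 1%N by lia.
    by rewrite /square_at fM.1 expr1n.
  have n4 : (2%:R ^+ 2 : C) != 0 by rewrite expf_neq0 // Num.Theory.pnatr_eq0.
  have f2n : square_at f (2 * n) by apply: even_case; lia.
  apply: (mulfI n4); rewrite -exprMn -natrM -f2n -f2 fM.2 ?coprime2n //; lia.
Qed.

Theorem theorem1p2 (R : realType) (f : nat -> R[i])
  (hGoldbach : goldbach_conjecture)
  (hf : multiplicative_arith f)
  (hf0 : f 0%N = 0)
  (hpq : forall p q : nat, prime p -> prime q -> (q <= p)%N ->
     f (p + q)%N + f (p - q)%N = 2%:R * f p + 2%:R * f q) :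
  forall n : nat, (0 < n)%N -> f n = n%:R ^+ 2.
Proof.
move=> n _.
have [sq_even sq_odd] :=
  square_at_weight (2 * n)%N hGoldbach hf hf0 (hpq : prime_quadratic f).
have [odd_n|even_n] := boolP (odd n); first by apply: sq_odd => //; lia.
by apply: sq_even; [lia|rewrite even_n].
Qed.
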